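(* Let $0<\alpha<1$, let $1\le p\le\infty$ (with $1/\infty=0$), and let $K_\alpha$ be the integral operator $$(K_\alpha f)(x)=\int_0^1 (1-xy)^{\alpha-1}f(y)\,dy,\qquad x\in[0,1].$$ Then the Kolmogorov $n$-widths of $K_\alpha$ are asymptotically bounded (as $n\to\infty$) as follows: (1) If $\frac1p<\alpha<1$, then $$d_n\left(K_\alpha: L^p[0,1]\to L^\infty[0,1]\right)\le O\left(2^{-\kappa_1\sqrt n}\right).$$ (2) If $\alpha=\frac1p$ and $1\le r<\infty$, then $$d_n\left(K_\alpha: L^p[0,1]\to L^r[0,1]\right)\le O\left(2^{-\kappa_2\sqrt n}\right).$$ (3) If $1\le r<\infty$ and $1-\frac1r<\alpha<\frac1p$, then $$d_n\left(K_\alpha: L^p[0,1]\to L^r[0,1]\right)\le O\left(2^{-\kappa_3\sqrt n}\right).$$ Here $\kappa_1,\kappa_2,\kappa_3$ are some positive constants with $\kappa_1<\frac{1}{\sqrt2}\left(\alpha-\frac1p\right)$, $\kappa_2<\frac{1}{\sqrt2}\cdot\frac1r$ and $\kappa_3<\frac{1}{\sqrt2}\left(1-\frac1p\right)$.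
   Context: For a subset $A$ of a Banach space $Y$ and $n=0,1,2,\dots$, the Kolmogorov $n$-width of $A$ in $Y$ is $$d_n(A,Y)=\inf_{\substack{Y_n\subset Y\\ \dim Y_n=n}}\ \sup_{f\in A}\ \inf_{g\in Y_n}\|f-g\|_Y,$$ where the outer infimum runs over all $n$-dimensional linear subspaces $Y_n$ of $Y$. For a linear operator $K:X\to Y$ between Banach spaces, $d_n(K)=d_n(K:X\to Y)=d_n(K(B_X),Y)$, where $B_X$ is the unit ball of $X$.
   Formalization: The bounds are proved for every positive κ below the stated limits; in (3) with p = 1 no positive κ₃ < (1/√2)(1 − 1/p) = 0 exists, so there only the existence of the operator K_α is asserted and no decay rate. *)

(* Defs.v *)
From HB Require Import structures.
From mathcomp Require Import all_boot all_order all_algebra generic_quotient.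
From mathcomp Require Import all_classical all_reals all_analysis.
From mathcomp Require Import measurable_realfun ess_sup_inf.

Set Implicit Arguments.
Unset Strict Implicit.
Unset Printing Implicit Defensive.
Import Order.TTheory GRing.Theory Num.Theory.
Import numFieldNormedType.Exports.
Local Open Scope classical_set_scope.
Local Open Scope ring_scope.

(** The library type [LspaceType mu p1] of almost-everywhere classes with finite
    [p]-norm comes without algebraic structure; here it is made a normed space. *)

Lemma ae_eq_Lnorm d (T : measurableType d) (R : realType)
    (mu : {measure set T -> \bar R}) (p : \bar R) (f g : T -> R) :
  measurable_fun setT f -> measurable_fun setT g -> f = g %[ae mu] ->
  ('N[mu]_p[EFin \o f] = 'N[mu]_p[EFin \o g])%E.
Proof.
move=> mf mg fg; rewrite unlock /Lnorm; case: p => [r||].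
- congr (_ `^ _)%E; apply: ae_eq_integral => //.
  + apply: (measurableT_comp (measurable_poweR _)) => //.
    exact/measurable_EFinP/measurableT_comp.
  + apply: (measurableT_comp (measurable_poweR _)) => //.
    exact/measurable_EFinP/measurableT_comp.
  + by apply: filterS fg => x /= /(_ I) -> _.
- case: ifP => // _; apply: eq_ess_sup.
  by apply: filterS fg => x /= /(_ I) ->.
- case: ifP => // _; apply: eq_ess_inf.
  by apply: filterS fg => x /= /(_ I) ->.
Qed.

Section Lspace_normed.
Context d (T : measurableType d) (R : realType).
Context (mu : {measure set T -> \bar R}) (p : \bar R) (p1 : (1 <= p)%E).
Notation LT := (LspaceType mu p1).
Notation LF := (LfunType mu p1).
Local Open Scope quotient_scope.

Lemma Lspace_repr_subproof (u : LT) : (u : T -> R) \in Lfun mu p.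
Proof.
apply/andP; split; rewrite inE /=.
- exact: (@measurable_funPT _ _ _ _ (repr (LebesgueSpace.sort u))).
- exact: Lebesgue_finite.
Qed.

Definition Lspace_repr (u : LT) : LF := Lfun_Sub p1 (Lspace_repr_subproof u).

Definition mfun_of_Lfun (f : LF) : {mfun T >-> measurableTypeR R} :=
  HB.pack_for {mfun T >-> measurableTypeR R} (f : T -> R)
    (@isMeasurableFun.Build _ _ T (measurableTypeR R) f (@measurable_funPT _ _ _ _ f)).

Definition mfun_class (f : LF) : {mfun_ mu, T >-> measurableTypeR R} :=
  \pi_({mfun_ mu, T >-> measurableTypeR R}) (mfun_of_Lfun f).

Lemma mfun_classE (f : LF) : (mfun_class f : T -> R) = f %[ae mu].
Proof.
rewrite /mfun_class /aqEqMfun_to_fun.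
have /eqP := reprK (mfun_class f); rewrite eqmodE => /asboolP.
exact.
Qed.

Lemma mfun_class_finite (f : LF) : finite_norm mu p (mfun_class f).
Proof.
rewrite /finite_norm (ae_eq_Lnorm _ _ _ (mfun_classE f)).
- exact: Lfunction_finite.
- exact: (@measurable_funPT _ _ _ _ (repr (mfun_class f))).
- exact: measurable_funPT.
Qed.

Definition Lspace_class (f : LF) : LT :=
  HB.pack_for (LspaceType mu p1) (mfun_class f)
    (@isFinLebesgue.Build d T R mu p p1 (mfun_class f) (mfun_class_finite f)).

Lemma Lspace_classE (f : LF) : (Lspace_class f : T -> R) = f %[ae mu].
Proof. exact: mfun_classE. Qed.

Lemma ae_app (P Q : T -> Prop) : (\forall x \ae mu, P x -> Q x) ->
  (\forall x \ae mu, P x) -> \forall x \ae mu, Q x.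
Proof. exact: filter_app. Qed.

Lemma Lspace_eqP (u v : LT) : (u : T -> R) = v %[ae mu] -> u = v.
Proof.
case: u v => [u [[uf]]] [v [[vf]]] /= uv.
have E : u = v.
  rewrite -[u]reprK -[v]reprK; apply/eqP; rewrite eqmodE.
  by apply/asboolP.
case: _ / E in vf uv *; congr LebesgueSpace.Pack.
congr LebesgueSpace.Class; congr isFinLebesgue.Axioms_.
exact: bool_irrelevance.
Qed.

HB.instance Definition _ := gen_eqMixin LT.
HB.instance Definition _ := gen_choiceMixin LT.

Definition Lspace_zero : LT := Lspace_class 0.
Definition Lspace_opp (u : LT) : LT := Lspace_class (- Lspace_repr u).
Definition Lspace_add (u v : LT) : LT :=
  Lspace_class (Lspace_repr u + Lspace_repr v).
Definition Lspace_scale (a : R) (u : LT) : LT := Lspace_class (a *: Lspace_repr u).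
Definition Lspace_norm (u : LT) : R := fine ('N[mu]_p[EFin \o (u : T -> R)])%E.

Lemma Lspace_zeroE : (Lspace_zero : T -> R) = cst 0 %[ae mu].
Proof. exact: Lspace_classE. Qed.

Lemma Lspace_oppE u : (Lspace_opp u : T -> R) = \- (u : T -> R) %[ae mu].
Proof. exact: Lspace_classE. Qed.

Lemma Lspace_addE u v :
  (Lspace_add u v : T -> R) = (u : T -> R) \+ (v : T -> R) %[ae mu].
Proof. exact: Lspace_classE. Qed.

Lemma Lspace_scaleE a u :
  (Lspace_scale a u : T -> R) = (fun x => a * (u : T -> R) x) %[ae mu].
Proof. exact: Lspace_classE. Qed.

Lemma Lspace_addrA : associative Lspace_add.
Proof.
move=> u v w; apply: Lspace_eqP.
apply: ae_app (Lspace_addE u (Lspace_add v w)).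
apply: ae_app (Lspace_addE v w).
apply: ae_app (Lspace_addE (Lspace_add u v) w).
apply: ae_app (Lspace_addE u v).
by apply: nearW => x /= E1 E2 E3 E4 _; rewrite E4// E3// E2// E1//= addrA.
Qed.

Lemma Lspace_addrC : commutative Lspace_add.
Proof.
move=> u v; apply: Lspace_eqP.
apply: ae_app (Lspace_addE u v); apply: ae_app (Lspace_addE v u).
by apply: nearW => x /= E1 E2 _; rewrite E2// E1//= addrC.
Qed.

Lemma Lspace_add0r : left_id Lspace_zero Lspace_add.
Proof.
move=> u; apply: Lspace_eqP.
apply: ae_app (Lspace_addE Lspace_zero u); apply: ae_app Lspace_zeroE.
by apply: nearW => x /= E1 E2 _; rewrite E2// E1//= add0r.
Qed.

Lemma Lspace_addNr : left_inverse Lspace_zero Lspace_opp Lspace_add.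
Proof.
move=> u; apply: Lspace_eqP.
apply: ae_app (Lspace_addE (Lspace_opp u) u).
apply: ae_app (Lspace_oppE u); apply: ae_app Lspace_zeroE.
by apply: nearW => x /= E1 E2 E3 _; rewrite E3// E2// E1//= addNr.
Qed.

HB.instance Definition _ := GRing.isZmodule.Build LT
  Lspace_addrA Lspace_addrC Lspace_add0r Lspace_addNr.

Lemma Lspace_scalerA a b u :
  Lspace_scale a (Lspace_scale b u) = Lspace_scale (a * b) u.
Proof.
apply: Lspace_eqP.
apply: ae_app (Lspace_scaleE a (Lspace_scale b u)).
apply: ae_app (Lspace_scaleE b u); apply: ae_app (Lspace_scaleE (a * b) u).
by apply: nearW => x /= E1 E2 E3 _; rewrite E3// E2// E1//= mulrA.
Qed.

Lemma Lspace_scale1r : left_id 1 Lspace_scale.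
Proof.
move=> u; apply: Lspace_eqP; apply: ae_app (Lspace_scaleE 1 u).
by apply: nearW => x /= E1 _; rewrite E1//= mul1r.
Qed.

Lemma Lspace_scalerDr : right_distributive Lspace_scale +%R.
Proof.
move=> a u v; apply: Lspace_eqP.
apply: ae_app (Lspace_scaleE a (Lspace_add u v)).
apply: ae_app (Lspace_addE u v).
apply: ae_app (Lspace_addE (Lspace_scale a u) (Lspace_scale a v)).
apply: ae_app (Lspace_scaleE a u); apply: ae_app (Lspace_scaleE a v).
apply: nearW => x /= E1 E2 E3 E4 E5 _.
by rewrite E5// E4// E3// E2// E1//= mulrDr.
Qed.

Lemma Lspace_scalerDl u : {morph Lspace_scale^~ u : a b / a + b}.
Proof.
move=> a b; apply: Lspace_eqP.
apply: ae_app (Lspace_scaleE (a + b) u).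
apply: ae_app (Lspace_addE (Lspace_scale a u) (Lspace_scale b u)).
apply: ae_app (Lspace_scaleE a u); apply: ae_app (Lspace_scaleE b u).
by apply: nearW => x /= E1 E2 E3 E4 _; rewrite E4// E3// E2// E1//= mulrDl.
Qed.

HB.instance Definition _ := GRing.Zmodule_isLmodule.Build R LT
  Lspace_scalerA Lspace_scale1r Lspace_scalerDr Lspace_scalerDl.

Lemma Lspace_norm_class (f : LF) :
  Lspace_norm (Lspace_class f) = fine ('N[mu]_p[EFin \o f])%E.
Proof.
congr fine; apply: ae_eq_Lnorm.
- exact: (@measurable_funPT _ _ _ _ (repr (mfun_class f))).
- exact: measurable_funPT.
- exact: Lspace_classE.
Qed.

Lemma Lspace_norm_repr (u : LT) :
  Lspace_norm u = fine ('N[mu]_p[EFin \o Lspace_repr u])%E.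
Proof. by []. Qed.

Lemma Lspace_ler_normD u v :
  Lspace_norm (u + v) <= Lspace_norm u + Lspace_norm v.
Proof. by rewrite Lspace_norm_class !Lspace_norm_repr; exact: ler_LnormD. Qed.

Lemma Lspace_normrZ a u : Lspace_norm (a *: u) = `|a| * Lspace_norm u.
Proof.
rewrite Lspace_norm_class Lspace_norm_repr; apply: EFin_inj.
by rewrite EFinM !finite_norm_fine; exact: LnormZ.
Qed.

Lemma Lspace_normr0_eq0 u : Lspace_norm u = 0 -> u = 0.
Proof.
rewrite Lspace_norm_repr => /fine_Lnormr_eq0 u0; apply: Lspace_eqP.
by apply: ae_eq_trans u0 _; apply: ae_eq_sym; exact: Lspace_zeroE.
Qed.

HB.instance Definition _ := Lmodule_isNormed.Build R LT
  Lspace_ler_normD Lspace_normrZ Lspace_normr0_eq0.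

Lemma Lspace_normE (u : LT) :
  (`|u|)%:E = ('N[mu]_p[EFin \o (u : T -> R)])%E.
Proof. exact: (finite_norm_fine (Lspace_repr u)). Qed.

End Lspace_normed.

Section kolmogorov_width.
Context (R : realType) (Y : normedModType R).

Definition linear_subspace_of_dim (n : nat) (W : set Y) : Prop :=
  exists2 e : 'I_n -> Y,
    (forall c : 'I_n -> R, \sum_(i < n) c i *: e i = 0 -> forall i, c i = 0) &
    W = [set \sum_(i < n) c i *: e i | c in [set: 'I_n -> R]].

(** Extended-real infima and suprema, so that the width of an unbounded set
    (or of any set when [n] exceeds the dimension of [Y]) may be [+oo]. *)
Definition kolmogorov_width (n : nat) (A : set Y) : \bar R :=
  ereal_inf [set ereal_sup [set ereal_inf [set (`|f - g|)%:E | g in W] | f in A]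
            | W in linear_subspace_of_dim n].

Definition operator_width (n : nat) (X : normedModType R) (K : X -> Y) : \bar R :=
  kolmogorov_width n (K @` [set f | `|f| <= 1]).

End kolmogorov_width.

Section unit_interval.
Context (R : realType).

Definition lebesgue01 : {measure set (measurableTypeR R) -> \bar R} :=
  mrestr lebesgue_measure (measurable_itv `[(0 : R), 1]).

(** [L^p[0,1]], real scalars: the elements are classes of functions defined on
    the whole line, two functions being identified when they agree almost
    everywhere on [[0, 1]]; values outside [[0, 1]] play no role. *)
Definition L01 (p : \bar R) (p1 : (1 <= p)%E) : normedModType R :=
  LspaceType lebesgue01 p1.

(** [1/p], with [1/oo = 0]. *)
Definition recip (p : \bar R) : R := fine (p^-1)%E.

Definition Kalpha (alpha : R) (f : R -> R) (x : R) : R :=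
  \int[lebesgue_measure]_(y in `[0, 1]) ((1 - x * y) `^ (alpha - 1) * f y).

(** [K] is the operator [K_alpha] between the two Lebesgue spaces; at most one
    such [K] exists, and its existence says that [K_alpha] maps [L^p[0,1]] into
    [L^q[0,1]]. The point [x = 1], where the integral may diverge, is
    negligible. *)
Definition is_Kalpha (alpha : R) (p q : \bar R) (p1 : (1 <= p)%E) (q1 : (1 <= q)%E)
    (K : L01 p1 -> L01 q1) : Prop :=
  forall f : L01 p1, (K f : R -> R) = Kalpha alpha f %[ae lebesgue01].

(** [d n <= O(2 ^ (- kappa * sqrt n))] as [n -> oo], stated in the extended reals
    so that it includes finiteness of [d n] for large [n]. *)
Definition root_exp_bigO (kappa : R) (d : nat -> \bar R) : Prop :=
  exists C : R, \forall n \near \oo,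
    (d n <= (C * 2 `^ (- (kappa * Num.sqrt n%:R)))%:E)%E.

End unit_interval.

(* Main.v *)
(** On [0, 1)^2 one has 1 - x y >= max (1 - x, 1 - y), so the kernel is dominated
    by (1 - x)^-a (1 - y)^-b as soon as a, b >= 0 and a + b = 1 - alpha; K_alpha
    is therefore bounded from L^p to L^q whenever (1 - x)^-a is in L^q and
    (1 - y)^-b is in the dual of L^p.

    On each of the m dyadic cells [1 - 2^-j, 1 - 2^-(j+1)) of y, the kernel is
    replaced by m terms of its binomial expansion at a point c of the cell: with
    1 - x y = (1 - x c) (1 - z) one has |z| <= 1/3, and the relative error is at
    most 3 2^-m.  For 1 - y <= 2^-m nothing is subtracted, but there
    1 <= (2^-m / (1 - y))^s.  So the error kernel of this approximation of rank
    m^2 is at most 4 (2^-m)^s times (1 - x)^-a (1 - y)^-b with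
    a + b = 1 - alpha + s: a gain of 2^(-m s) costs s in the exponent b, or in a
    after exchanging x and y.  With m about sqrt n and s = kappa, the three cases
    only differ in the choice of (a, b), namely (0, 1 - alpha + kappa),
    (delta + kappa, 1 - alpha - delta) with delta small, and
    (1 - alpha, kappa). *)

From HB Require Import structures.
Require Import Defs.
From mathcomp Require Import all_boot all_order all_algebra.
From mathcomp Require Import all_classical all_reals all_analysis.
From mathcomp Require Import measurable_realfun ess_sup_inf.
From mathcomp Require Import ring lra.
Import Order.TTheory GRing.Theory Num.Theory.
Import numFieldNormedType.Exports.
Local Open Scope classical_set_scope.
Local Open Scope ring_scope.
Set Implicit Arguments.
Unset Strict Implicit.
Unset Printing Implicit Defensive.

(** * Truncated binomial series *)

(** The coefficient of z^k in (1 - z)^(-g), that is g (g + 1) ... (g + k - 1) / k!. *)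
Fixpoint binom_coef (R : realType) (g : R) (k : nat) : R :=
  if k is j.+1 then (j%:R + g) / j.+1%:R * binom_coef g j else 1.

Definition binom_poly (R : realType) (g : R) (N : nat) (z : R) : R :=
  \sum_(k < N) binom_coef g k * z ^+ k.

Lemma binom_coef_bound (R : realType) (g : R) k :
  0 <= g <= 1 -> 0 <= binom_coef g k <= 1.
Proof.
move=> g01; elim: k => [|k IH] /=; first by rewrite ler01 lexx.
have k0 : (0 : R) <= k%:R by [].
have kS : (0 : R) < k.+1%:R by [].
apply/andP; split; first by rewrite mulr_ge0 ?divr_ge0//; lra.
rewrite -[leRHS](mulr1 1) ler_pM ?divr_ge0 ?ler_pdivrMr//; [lra|lra| |lra].
by rewrite -natr1; lra.
Qed.

Lemma is_derive_binom_poly (R : realType) (g : R) N (z : R) :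
  is_derive z 1 (binom_poly g N) (\sum_(k < N) binom_coef g k * (z ^+ k.-1 *+ k)).
Proof.
elim: N => [|N IH].
  rewrite big_ord0 (_ : binom_poly g 0 = cst 0); first exact: is_derive_cst.
  by apply/funext => y; rewrite /binom_poly big_ord0.
rewrite big_ord_recr (_ : binom_poly g N.+1 =
    binom_poly g N + (binom_coef g N \*: (fun y : R => y ^+ N))); last first.
  by apply/funext => y; rewrite /binom_poly big_ord_recr.
apply: is_deriveD; apply: is_deriveZ.
apply: DeriveDef; first exact: exprn_derivable.
by rewrite exp_derive /GRing.scale /= mulr1 mulr_natl.
Qed.

(** The full series f solves (1 - z) f' = g f. Since (k + 1) a_(k+1) = (k + g) a_k, the coefficients
    cancel below the cut and truncation leaves a single term of top degree. *)
Lemma binom_poly_ode (R : realType) (g z : R) N :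
  (1 - z) * (\sum_(k < N.+1) binom_coef g k * (z ^+ k.-1 *+ k)) =
    g * binom_poly g N.+1 z - N.+1%:R * binom_coef g N.+1 * z ^+ N.
Proof.
elim: N => [|N IH].
  by rewrite /binom_poly !big_ord_recr !big_ord0 /= expr0; field.
rewrite [in LHS]big_ord_recr [in RHS]/binom_poly [in RHS]big_ord_recr /=.
rewrite -/(binom_poly g N.+1 z) mulrDr IH [RHS]/=.
rewrite -mulr_natr !exprS.
set c := binom_coef g N; set P := binom_poly _ _ _.
rewrite -/(binom_coef g N.+1) /= -/c.
have n1 : N.+1%:R != 0 :> R by [].
have n2 : N.+2%:R != 0 :> R by [].
move: n1 n2; rewrite -!natr1; set n : R := N%:R => n1 n2.
by field; apply/andP.
Qed.

Lemma is_derive_onem_powR (R : realType) (a x : R) : x < 1 ->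
  is_derive x (1 : R) (fun y : R => (1 - y) `^ a) (a * (1 - x) `^ (a - 1) * -1).
Proof.
move=> x1; have y1 : 0 < 1 - x by lra.
have d1 : is_derive x (1 : R) (fun y : R => 1 - y) (- 1).
  rewrite (_ : (fun y : R => 1 - y) = cst 1 - id); last by apply/funext.
  by rewrite -[X in is_derive _ _ _ X]add0r; apply: is_deriveB.
apply: (@is_derive1_comp R (@powR R ^~ a) (fun y : R => 1 - y)).
exact: is_derive1_powR.
Qed.

(** The factor N in the remainder is traded for (3/2)^N, which turns 3^-N into 2^-N. *)
Lemma natr_le_expr (R : realType) N : N%:R <= 2 * (3 / 2) ^+ N :> R.
Proof.
have H M : 1 <= (3 / 2 : R) ^+ M by apply: exprn_ege1; lra.
elim: N => [|N IH]; first by rewrite expr0; lra.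
have := H N; rewrite exprS -(natr1 N) => H1.
lra.
Qed.

Lemma powR_predK (R : realType) (x g : R) : 0 < x -> x * x `^ (g - 1) = x `^ g.
Proof.
move=> x0; have {1}-> : x = x `^ 1 by rewrite powRr1// ltW.
by rewrite -powRD ?subrKC// (gt_eqF x0) implybT.
Qed.

(* With P the truncated series, the ODE above makes the derivative of
   P(y) (1 - y)^g the single term - N a_N y^(N-1) (1 - y)^(g-1). *)
Lemma binom_poly_rel_error (R : realType) (g z : R) N :
  0 <= g <= 1 -> `|z| <= 3^-1 ->
  `|1 - binom_poly g N z * (1 - z) `^ g| <= 3 * 2^-1 ^+ N.
Proof.
move=> g01 z3.
have pz (y : R) : `|y| <= 3^-1 -> 2 / 3 <= 1 - y by rewrite ler_norml => /andP[]; lra.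
case: N => [|N].
  rewrite /binom_poly big_ord0 mul0r subr0 normr1 expr0; lra.
pose F (y : R) := binom_poly g N.+1 y * (1 - y) `^ g.
pose dF (y : R) : R := - (N.+1%:R * binom_coef g N.+1 * y ^+ N) * (1 - y) `^ (g - 1).
have dFP (y : R) : `|y| <= 3^-1 -> is_derive y (1 : R) F (dF y).
  move=> /pz y3.
  have y1 : 0 < 1 - y by lra.
  have y2 : y < 1 by lra.
  have -> : F = binom_poly g N.+1 * (fun y : R => (1 - y) `^ g) by apply/funext.
  apply: (is_derive_eq (is_deriveM (is_derive_binom_poly g N.+1 y) (is_derive_onem_powR g y2))).
  have -> : (1 - y) `^ g = (1 - y) * (1 - y) `^ (g - 1).
    by rewrite powR_predK.
  have := binom_poly_ode g y N.
  rewrite /dF /GRing.scale /=.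
  set S := \sum_(_ < _) _; set P := binom_poly _ _ _; set Q := _ `^ _ => ode.
  have -> : P * (g * Q * -1) + (1 - y) * Q * S = ((1 - y) * S - g * P) * Q by ring.
  by rewrite ode; congr (_ * Q); ring.
have F0 : F 0 = 1.
  rewrite /F subr0 powR1 mulr1 /binom_poly big_ord_recl expr0 mulr1 big1 ?addr0// => i _.
  by rewrite expr0n mulr0.
have cF a b : a <= b -> (forall x, x \in `[a, b] -> `|x| <= 3^-1) ->
    {within `[a, b], continuous F}.
  move=> ab H; apply: derivable_within_continuous => x /H /dFP dx.
  exact: (@ex_derive _ _ _ _ _ _ _ dx).
(* Mean value theorem between 0 and z, the two signs of z being treated separately. *)
have [c cz Fz] : exists2 c, `|c| <= `|z| & F z - F 0 = dF c * z.
  case: (leP 0 z) => z0.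
    have H x : x \in `[0, z] -> `|x| <= `|z|.
      by rewrite in_itv /= => /andP[? ?]; rewrite !ger0_norm.
    have dH x : x \in `]0, z[ -> is_derive x (1 : R) F (dF x).
      by move=> /subset_itv_oo_cc /H h; apply: dFP; apply: le_trans z3.
    have [c cz ->] := MVT_segment z0 dH (cF _ _ z0 (fun x h => le_trans (H x h) z3)).
    by exists c; rewrite ?H// subr0.
  have H x : x \in `[z, 0] -> `|x| <= `|z|.
    by rewrite in_itv /= => /andP[? ?]; rewrite !ler0_norm// ?lerN2// ltW.
  have dH x : x \in `]z, 0[ -> is_derive x (1 : R) F (dF x).
    by move=> /subset_itv_oo_cc /H h; apply: dFP; apply: le_trans z3.
  have [c cz h] :=
    MVT_segment (ltW z0) dH (cF _ _ (ltW z0) (fun x h => le_trans (H x h) z3)).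
  by exists c; rewrite ?H// -opprB h sub0r mulrN opprK.
rewrite -/(F z) distrC -{1}F0 Fz normrM /dF normrM normrN normrM normrM.
have /andP[b0 b1] := binom_coef_bound N.+1 g01.
have c3 := pz c (le_trans cz z3).
rewrite (ger0_norm b0) (ger0_norm (powR_ge0 _ _)) normr_nat normrX.
have Q1 : (1 - c) `^ (g - 1) <= 3 / 2.
  rewrite -(opprB 1 g) powRN.
  have h1 : 2 / 3 <= (1 - c) `^ (1 - g).
    apply: le_trans (_ : (2 / 3) `^ (1 - g) <= _).
      by apply: ger1_powR; lra.
    by apply: ge0_ler_powR; rewrite ?nnegrE; lra.
  rewrite -[3 / 2]invf_div lef_pV2 ?posrE//; lra.
(* With N the number of terms, the remainder is at most 3/2 times N 3^-N, and N 3^-N is at most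
   twice 2^-N: hence the constant 3. *)
apply: le_trans (_ : N.+1%:R * 1 * 3^-1 ^+ N * (3 / 2) * 3^-1 <= _).
  have h1 : `|c| ^+ N <= 3^-1 ^+ N by rewrite lerXn2r ?nnegrE//; exact: le_trans cz z3.
  move: (binom_coef g N.+1) b0 b1 => B b0 b1.
  apply: ler_pM; rewrite ?mulr_ge0 ?exprn_ge0 ?powR_ge0//.
  apply: ler_pM; rewrite ?mulr_ge0 ?exprn_ge0 ?powR_ge0//.
  apply: ler_pM; rewrite ?mulr_ge0 ?exprn_ge0//.
  by apply: ler_pM.
have h2 := natr_le_expr R N.+1.
have E2 : (3 / 2 : R) ^+ N.+1 = 2^-1 ^+ N.+1 / 3^-1 ^+ N.+1.
  by rewrite -expr_div_n; congr (_ ^+ _); field.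
have p3 : 0 < (3^-1 : R) ^+ N.+1 by apply: exprn_gt0; lra.
rewrite E2 mulrA ler_pdivlMr// in h2.
have -> : N.+1%:R * 1 * 3^-1 ^+ N * (3 / 2) * 3^-1 = 3 / 2 * (N.+1%:R * 3^-1 ^+ N.+1) :> R.
  by rewrite exprSr; ring.
move: h2; move: (N.+1%:R * _) (2^-1 ^+ _) => X Y h2; lra.
Qed.

Lemma le_powRN (R : realType) (d t s : R) :
  0 < d -> d <= t -> 0 <= s -> t `^ (- s) <= d `^ (- s).
Proof.
move=> d0 dt s0; have t0 := lt_le_trans d0 dt.
rewrite !powRN lef_pV2 ?posrE ?powR_gt0//.
by apply: ge0_ler_powR => //; rewrite nnegrE ltW.
Qed.

(** * Dyadic approximation of the kernel *)

Definition dyadic_cell (R : realType) (j : nat) : set R :=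
  `[1 - 2^-1 ^+ j, 1 - 2^-1 ^+ j.+1[.
Arguments dyadic_cell : clear implicits.

Definition dyadic_mid (R : realType) (j : nat) : R := 1 - 3 / 4 * 2^-1 ^+ j.

Lemma dyadic_cell_cover (R : realType) (m : nat) (y : R) :
  0 <= y -> y < 1 - 2^-1 ^+ m -> exists j : 'I_m, y \in dyadic_cell R j.
Proof.
move=> y0; elim: m => [|m IH]; first by rewrite expr0; lra.
case: (ltP y (1 - 2^-1 ^+ m)) => [/IH[j yj] _|ym yM].
  by exists (widen_ord (leqnSn m) j).
by exists ord_max; rewrite inE /dyadic_cell /= in_itv /= ym yM.
Qed.

(** Applied in both directions, this is the disjointness of the cells. *)
Lemma dyadic_cell_le (R : realType) (i j : nat) (y : R) :
  y \in dyadic_cell R i -> y \in dyadic_cell R j -> (i <= j)%N.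
Proof.
rewrite !inE /dyadic_cell /= !in_itv /= => /andP[iy _] /andP[_ yj].
rewrite leqNgt; apply/negP => ji.
have : (2^-1 : R) ^+ i <= 2^-1 ^+ j.+1 by apply: ler_wiXn2l => //; lra.
by move=> h; lra.
Qed.

(** With c the midpoint, |y - c| <= 2^-j / 4 while 1 - x c >= 1 - c = (3/4) 2^-j, so the quotient is
    at most 1/3. It is the z for which 1 - x y = (1 - x c) (1 - z). *)
Lemma dyadic_cell_mid (R : realType) (j : nat) (x y : R) :
  0 <= x <= 1 -> y \in dyadic_cell R j ->
  0 < 1 - x * dyadic_mid R j /\
  `|x * (y - dyadic_mid R j) / (1 - x * dyadic_mid R j)| <= 3^-1.
Proof.
move=> /andP[x0 x1]; rewrite !inE /dyadic_cell /dyadic_mid /= !in_itv /= exprS.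
set e := 2^-1 ^+ j => /andP[y1 y2].
have e0 : 0 < e by apply: exprn_gt0; lra.
have e1 : e <= 1 by apply: exprn_ile1; lra.
have h : 3 / 4 * e <= 1 - x * (1 - 3 / 4 * e) by nra.
split; first by lra.
have p : 0 < 1 - x * (1 - 3 / 4 * e) by lra.
rewrite normrM normfV (gtr0_norm p) ler_pdivrMr// normrM (ger0_norm x0).
have : `|y - (1 - 3 / 4 * e)| <= e / 4 by rewrite ler_norml; apply/andP; split; lra.
move: (normr_ge0 (y - (1 - 3 / 4 * e))); move: `|_| => A A0 A1.
nra.
Qed.

Lemma dyadic_mid_gap (R : realType) (j : nat) (x : R) : 0 <= x <= 1 ->
  3 / 4 * 2^-1 ^+ j <= 1 - x * dyadic_mid R j.
Proof.
move=> /andP[x0 x1]; rewrite /dyadic_mid; set e := 2^-1 ^+ j.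
have e0 : 0 < e by apply: exprn_gt0; lra.
have e1 : e <= 1 by apply: exprn_ile1; lra.
nra.
Qed.

(** The index pairs a cell with an order of expansion. The Boolean read as 0 or 1 marks the strip
    beyond all [m] cells, where the relative error is 1. The bounds on [0, 1) serve to place the
    [u i] in L^q and to pair the [v i] with functions in L^p. *)
Lemma kernel_finite_rank (R : realType) (g : R) (m : nat) : 0 <= g <= 1 ->
  exists u v : 'I_m * 'I_m -> R -> R,
  [/\ forall i, measurable_fun setT (u i), forall i, measurable_fun setT (v i),
      forall i, exists M : R, forall x : R, 0 <= x < 1 -> `|u i x| <= M,
      forall i, exists M : R, forall x : R, 0 <= x < 1 -> `|v i x| <= M &
      forall x y : R, 0 <= x < 1 -> 0 <= y < 1 ->
        `|(1 - x * y) `^ (- g) - \sum_i u i x * v i y| <=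
        (3 * 2^-1 ^+ m + (1 - 2^-1 ^+ m <= y)%R%:R) * (1 - x * y) `^ (- g)].
Proof.
move=> g01; have g0 : 0 <= g by lra.
pose c j := dyadic_mid R j.
pose u (i : 'I_m * 'I_m) (x : R) := x ^+ i.2 * (1 - x * c i.1) `^ (- (g + i.2%:R)).
pose v (i : 'I_m * 'I_m) (y : R) :=
  \1_(dyadic_cell R i.1) y * (binom_coef g i.2 * (y - c i.1) ^+ i.2).
exists u, v; split=> [i|i|i|i|x y x01 y01].
- apply: measurable_funM; first exact: measurable_funX.
  apply: (measurableT_comp (measurable_powR _)) => //.
  by apply: measurable_funB => //; apply: measurable_funM.
- apply: measurable_funM; first by apply: measurable_indic; exact: measurable_itv.
  apply: measurable_funM => //; apply: measurable_funX.
  exact: measurable_funB.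
- exists ((3 / 4 * 2^-1 ^+ i.1) `^ (- (g + i.2%:R))) => x /andP[x0 x1].
  rewrite /u normrM -[leRHS]mul1r ler_pM//.
    by rewrite normrX exprn_ile1// ger0_norm// ltW.
  rewrite ger0_norm ?powR_ge0//; apply: le_powRN; last exact: addr_ge0.
    by apply: mulr_gt0; [lra|apply: exprn_gt0; lra].
  by apply: dyadic_mid_gap; lra.
- exists 1 => y /andP[y0 y1].
  rewrite /v normrM -[leRHS]mul1r ler_pM//.
    by rewrite indicE ger0_norm// lern1 leq_b1.
  rewrite normrM -[leRHS]mul1r ler_pM//.
    by have /andP[b0 b1] := binom_coef_bound i.2 g01; rewrite ger0_norm.
  rewrite normrX exprn_ile1//.
  have e0 : 0 < (2^-1 : R) ^+ i.1 by apply: exprn_gt0; lra.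
  have e1 : (2^-1 : R) ^+ i.1 <= 1 by apply: exprn_ile1; lra.
  by rewrite /c /dyadic_mid ler_norml; apply/andP; split; lra.
pose z j := x * (y - c j) / (1 - x * c j).
have x01' : 0 <= x <= 1 by lra.
have xc j : 0 < 1 - x * c j.
  have := dyadic_mid_gap j x01'; apply: lt_le_trans.
  by apply: mulr_gt0; [lra|apply: exprn_gt0; lra].
(* Within one cell, collecting the powers of 1 - x c sums the [m] terms to the truncated series at
   [z j]. *)
have -> : \sum_i u i x * v i y =
    \sum_(j < m) \1_(dyadic_cell R j) y * ((1 - x * c j) `^ (- g) * binom_poly g m (z j)).
  rewrite -(pair_bigA _ (fun j k => u (j, k) x * v (j, k) y)) /=.
  apply: eq_bigr => j _; rewrite !mulr_sumr; apply: eq_bigr => k _.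
  rewrite /u /v /= opprD powRD; last by rewrite (gt_eqF (xc j)) implybT.
  rewrite [_ `^ (- k%:R)]powRN powR_mulrn ?(ltW (xc j))// /z expr_div_n exprMn.
  by rewrite -!mulrA; ring.
(* On the strip every cell indicator vanishes, so the error is the kernel itself. *)
case: (leP (1 - 2^-1 ^+ m) y) => ym /=.
  rewrite big1 ?subr0.
    rewrite ger0_norm ?powR_ge0// ler_peMl ?powR_ge0//.
    have : 0 <= (2^-1 : R) ^+ m by apply: exprn_ge0; lra.
    by lra.
  move=> j _; rewrite indicE memNset ?mul0r// /dyadic_cell /= in_itv /= => /andP[_].
  rewrite ltNge => /negP; apply; apply: le_trans ym; rewrite lerD2l lerN2.
  by apply: ler_wiXn2l => //; lra.
(* Elsewhere y lies in exactly one cell, and only its truncated series survives. *)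
have [j yj] : exists j : 'I_m, y \in dyadic_cell R j.
  by apply: dyadic_cell_cover => //; lra.
rewrite (bigD1 j)//= big1 ?addr0; last first.
  move=> i; apply: contraNeq; rewrite mulf_eq0 negb_or indicE => /andP[+ _].
  case: (boolP (y \in _)); rewrite ?eqxx// => yi _; apply/eqP/val_inj/eqP.
  by rewrite eqn_leq (dyadic_cell_le yi yj) (dyadic_cell_le yj yi).
rewrite indicE yj mul1r.
have [_ z3] := dyadic_cell_mid x01' yj; rewrite -/(c j) -/(z j) in z3.
have z1 : 0 < 1 - z j by move: z3; rewrite ler_norml => /andP[]; lra.
have E : 1 - x * y = (1 - x * c j) * (1 - z j).
  by rewrite /z; field; rewrite gt_eqF.
rewrite E powRM ?(ltW (xc j)) ?(ltW z1)// powRN [(1 - z j) `^ _]powRN.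
set A := (_ `^ _)^-1; set B := (1 - z j) `^ g.
have A0 : 0 <= A by rewrite invr_ge0 powR_ge0.
have B0 : 0 < B by rewrite powR_gt0.
(* [A * B^-1] is the kernel; factoring it out leaves the relative error of the truncated series. *)
have -> : A * B^-1 - A * binom_poly g m (z j) = A * B^-1 * (1 - binom_poly g m (z j) * B).
  by field; rewrite gt_eqF.
have AB : 0 <= A * B^-1 by apply: mulr_ge0 => //; rewrite invr_ge0 ltW.
rewrite normrM [leRHS]mulrC (ger0_norm AB).
by apply: ler_wpM2l => //; exact: binom_poly_rel_error.
Qed.

(** * Free families and widths *)

(** [free_family] and [lin_span] name the two clauses of [linear_subspace_of_dim]. *)
Definition free_family (R : realType) (Y : lmodType R) (n : nat) (e : 'I_n -> Y) :=
  forall c : 'I_n -> R, \sum_(i < n) c i *: e i = 0 -> forall i, c i = 0.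

Definition lin_span (R : realType) (Y : lmodType R) (n : nat) (e : 'I_n -> Y) : set Y :=
  [set \sum_(i < n) c i *: e i | c in [set: 'I_n -> R]].

Lemma lin_span_sum (R : realType) (Y : lmodType R) (n : nat) (e : 'I_n -> Y)
    (I : finType) (c : I -> R) (u : I -> Y) :
  (forall i, lin_span e (u i)) -> lin_span e (\sum_i c i *: u i).
Proof.
move=> h.
have ue i : exists a : 'I_n -> R, \sum_(j < n) a j *: e j = u i.
  by have [a _ <-] := h i; exists a.
have [a ua] := choice ue.
exists (fun j => \sum_i c i * a i j) => //.
under eq_bigr do rewrite scaler_suml.
rewrite exchange_big /=; apply: eq_bigr => i _.
rewrite -ua scaler_sumr; apply: eq_bigr => j _.
by rewrite scalerA.
Qed.

(* Steinitz: n + 1 vectors in the span of n vectors are given by an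
   (n + 1) x n matrix, whose left kernel is nonzero. *)
Lemma free_family_not_in_span (R : realType) (Y : lmodType R) (n : nat)
    (e : 'I_n -> Y) (f : 'I_n.+1 -> Y) :
  free_family f -> exists i, ~ lin_span e (f i).
Proof.
move=> ff; apply: contrapT => /forallNP h.
have fe i : exists a : 'I_n -> R, \sum_(j < n) a j *: e j = f i.
  by have /contrapT[a _ <-] := h i; exists a.
have [a fa] := choice fe.
pose M : 'M[R]_(n.+1, n) := \matrix_(i, j) a i j.
have : kermx M != 0.
  by rewrite -mxrank_eq0 mxrank_ker subn_eq0 -ltnNge ltnS rank_leq_col.
case/rowV0Pn => v /sub_kermxP vM /eqP; apply.
apply/rowP => i; rewrite mxE; apply: (ff (fun i => v 0 i)).
under eq_bigr do rewrite -fa scaler_sumr.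
rewrite exchange_big big1 //= => j _.
have := congr1 (fun A : 'rV[R]_n => A 0 j) vM; rewrite !mxE => vj.
rewrite -[RHS](scale0r (e j)) -vj scaler_suml.
by apply: eq_bigr => k _; rewrite mxE scalerA.
Qed.

(** If [w] lies outside the span of [e], it is the vector to append. Otherwise one of the n + 1
    vectors of [f] escapes that span by dimension count and is appended instead. *)
Lemma extend_free_family (R : realType) (Y : lmodType R) (n : nat)
    (e : 'I_n -> Y) (f : 'I_n.+1 -> Y) (w : Y) :
  free_family e -> free_family f ->
  exists2 e' : 'I_n.+1 -> Y, free_family e' &
    lin_span e' w /\ (forall y, lin_span e y -> lin_span e' y).
Proof.
move=> fe /(free_family_not_in_span e)[i0 fi0].
wlog nw : w / ~ lin_span e w.
  move=> H; have [[c _ cw]|] := pselect (lin_span e w); last exact: H.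
  have [e' fe' [_ ee']] := H _ fi0.
  by exists e' => //; split=> //; apply: ee'; exists c.
pose e' (i : 'I_n.+1) := if unlift ord_max i is Some j then e j else w.
have Ee' (c : 'I_n.+1 -> R) : \sum_i c i *: e' i =
    \sum_(i < n) c (lift ord_max i) *: e i + c ord_max *: w.
  rewrite (bigD1_ord ord_max) //= addrC; congr (_ + _).
    by apply: eq_bigr => i _; rewrite /e' liftK.
  by rewrite /e' unlift_none.
exists e'.
  move=> c; rewrite Ee' => c0.
  have cm : c ord_max = 0.
    apply: contra_notP nw => /eqP cm.
    exists (fun i => - ((c ord_max)^-1 * c (lift ord_max i))) => //.
    have cw : c ord_max *: w = - \sum_(i < n) c (lift ord_max i) *: e i.
      by apply/eqP; rewrite -addr_eq0 addrC c0.
    apply: (scalerI cm); rewrite cw scaler_sumr -sumrN; apply: eq_bigr => i _.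
    by rewrite scalerA mulrN mulrA divff// mul1r scaleNr.
  move: c0; rewrite cm scale0r addr0 => /fe h i.
  by case: (unliftP ord_max i) => [j ->|->]; [exact: (h j)|].
split.
  exists (fun i => (i == ord_max)%:R) => //; rewrite Ee' eqxx scale1r big1 ?add0r// => i _.
  by rewrite eq_sym (negbTE (neq_lift _ _)) scale0r.
move=> _ [c _ <-]; exists (fun i => if unlift ord_max i is Some j then c j else 0) => //.
rewrite Ee' unlift_none scale0r addr0.
by apply: eq_bigr => i _; rewrite liftK.
Qed.

(** Induction on [N]: each [u i] raises the dimension by exactly one, a fresh vector replacing it
    when it is dependent; the other n - N dimensions are filled in the base case. *)
Lemma free_family_span_of (R : realType) (Y : lmodType R) (N n : nat) (u : 'I_N -> Y) :
  (forall n, exists f : 'I_n -> Y, free_family f) -> (N <= n)%N ->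
  exists2 e : 'I_n -> Y, free_family e & forall i, lin_span e (u i).
Proof.
move=> ff; elim: N n u => [|N IH] n u.
  by move=> _; have [f fe] := ff n; exists f => // -[].
case: n => // n; rewrite ltnS => Nn.
have [e fe ue] := IH n (fun i => u (lift ord_max i)) Nn.
have [f ff'] := ff n.+1.
have [e' fe' [we' ee']] := extend_free_family (u ord_max) fe ff'.
exists e' => // i; case: (unliftP ord_max i) => [j ->|->] //.
exact/ee'/ue.
Qed.

(* The dimension of the subspace in [kolmogorov_width] is exactly [n]; a smaller
   approximating space has to be enlarged. *)
Lemma operator_width_le (R : realType) (X Y : normedModType R) (K : X -> Y)
    (I : finType) (u : I -> Y) (n : nat) (eps : R) :
  (forall n, exists f : 'I_n -> Y, free_family f) -> (#|I| <= n)%N ->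
  (forall f : X, `|f| <= 1 -> exists c : I -> R, `|K f - \sum_i c i *: u i| <= eps) ->
  (operator_width n K <= eps%:E)%E.
Proof.
move=> ff In H.
have [e fe ue] := free_family_span_of (fun i : 'I_#|I| => u (enum_val i)) ff In.
apply: ge_ereal_inf; exists (ereal_sup [set
    ereal_inf [set `|f - g|%:E | g in lin_span e] | f in K @` [set f | `|f| <= 1]]).
  by exists (lin_span e) => //; exists e.
apply: ge_ereal_sup => _ [_ [f f1 <-] <-].
have [c cf] := H f f1.
apply: ge_ereal_inf; exists `|K f - \sum_i c i *: u i|%:E; last by rewrite lee_fin.
exists (\sum_i c i *: u i) => //; apply: lin_span_sum => i.
by rewrite -(enum_rankK i); exact: ue.
Qed.

(** * Domination in Lebesgue spaces *)

Lemma ae_imply d (T : measurableType d) (R : realType)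
    (mu : {measure set T -> \bar R}) (P Q : T -> Prop) :
  (forall x, P x -> Q x) -> (\forall x \ae mu, P x) -> \forall x \ae mu, Q x.
Proof. by move=> PQ; apply: filterS. Qed.

Lemma ae_imply2 d (T : measurableType d) (R : realType)
    (mu : {measure set T -> \bar R}) (P Q S : T -> Prop) :
  (forall x, P x -> Q x -> S x) -> (\forall x \ae mu, P x) ->
  (\forall x \ae mu, Q x) -> \forall x \ae mu, S x.
Proof. by move=> PQ; apply: filterS2. Qed.

Section Lspace_domination.
Context d (T : measurableType d) (R : realType).
Context (mu : {measure set T -> \bar R}) (p : \bar R) (p1 : (1 <= p)%E).

Lemma le_Lnorm (f g : T -> R) : measurable_fun setT f -> measurable_fun setT g ->
  (\forall x \ae mu, `|f x| <= `|g x|) ->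
  ('N[mu]_p[EFin \o f] <= 'N[mu]_p[EFin \o g])%E.
Proof.
move=> mf mg fg; rewrite unlock /Lnorm; case: p p1 => [r| |//].
- rewrite lee_fin => r1; have r0 : 0 <= r by lra.
  apply: gt0_ler_poweR.
  + by rewrite invr_ge0.
  + by rewrite in_itv /= leey andbT; apply: integral_ge0 => x _; rewrite lee_fin powR_ge0.
  + by rewrite in_itv /= leey andbT; apply: integral_ge0 => x _; rewrite lee_fin powR_ge0.
  have mpow (h : T -> R) : measurable_fun setT h ->
      measurable_fun setT (fun x => `|(EFin \o h) x| `^ r)%E.
    move=> mh; apply: (measurableT_comp (measurable_poweR _)) => //.
    exact/measurable_EFinP/measurableT_comp.
  apply: ae_ge0_le_integral => //.
  + by move=> x _; rewrite lee_fin powR_ge0.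
  + exact: mpow.
  + by move=> x _; rewrite lee_fin powR_ge0.
  + exact: mpow.
  + apply: filterS fg => x /= fgx _; rewrite lee_fin.
    by apply: ge0_ler_powR => //; rewrite nnegrE.
- move=> _; case: ifP => // _; apply: le_ess_sup.
  by apply: filterS fg => x /= fgx; rewrite lee_fin.
Qed.

Lemma measurable_Lspace (u : LspaceType mu p1) : measurable_fun setT (u : T -> R).
Proof. exact: (@measurable_funPT _ _ _ _ (repr (LebesgueSpace.sort u))). Qed.

Lemma le_Lspace_norm (u v : LspaceType mu p1) :
  (\forall x \ae mu, `|(u : T -> R) x| <= `|(v : T -> R) x|) -> `|u| <= `|v|.
Proof.
move=> uv; rewrite -lee_fin !Lspace_normE; apply: le_Lnorm => //; exact: measurable_Lspace.
Qed.

Lemma Lspace_of_fun (f : T -> R) : measurable_fun setT f ->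
  ('N[mu]_p[EFin \o f] < +oo)%E ->
  exists u : LspaceType mu p1, (u : T -> R) = f %[ae mu].
Proof.
move=> mf Nf.
have fP : f \in Lfun mu p by apply/andP; split; rewrite inE.
by exists (Lspace_class (Lfun_Sub p1 fP)); exact: Lspace_classE.
Qed.

(** Images under the operator, the factors [u i] and the cell indicators all become classes by
    comparison with a multiple of a weight. *)
Lemma Lspace_dominated (f : T -> R) (v : LspaceType mu p1) :
  measurable_fun setT f -> (\forall x \ae mu, `|f x| <= `|(v : T -> R) x|) ->
  exists u : LspaceType mu p1, (u : T -> R) = f %[ae mu].
Proof.
move=> mf fv; apply: Lspace_of_fun => //.
apply: (@le_lt_trans _ _ 'N[mu]_p[EFin \o (v : T -> R)])%E.
  by apply: le_Lnorm => //; exact: measurable_Lspace.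
by rewrite -Lspace_normE ltry.
Qed.

Lemma Lspace_sumE (I : finType) (c : I -> R) (u : I -> LspaceType mu p1) :
  ((\sum_i c i *: u i : LspaceType mu p1) : T -> R) =
    (fun x => \sum_i c i * (u i : T -> R) x) %[ae mu].
Proof.
elim: (index_enum I) => [|i s IH].
  rewrite big_nil; have := Lspace_zeroE mu p1; apply: filterS => x /= h _.
  by rewrite (h Logic.I) big_nil.
rewrite big_cons; apply: ae_app IH.
apply: ae_app (Lspace_addE (c i *: u i) (\sum_(j <- s) c j *: u j)).
apply: ae_app (Lspace_scaleE (c i) (u i)).
apply: nearW => x /= h1 h2 h3 _.
by rewrite big_cons h2// h1// -h3.
Qed.

End Lspace_domination.

(** * Lebesgue measure on the unit interval *)

Section lebesgue01_facts.
Context (R : realType).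
Notation mu := (lebesgue01 R).
Notation leb := (@lebesgue_measure R).

(** The endpoint 1 is discarded too: there 1 - x vanishes and its negative powers take a default
    value. *)
Lemma lebesgue01_ae : \forall x \ae mu, 0 <= x < 1.
Proof.
exists (~` `[0, 1[); split.
- by apply: measurableC; exact: measurable_itv.
- rewrite /lebesgue01 /= /mrestr.
  rewrite (_ : _ `&` _ = [set 1]) ?lebesgue_measure_set1//.
  apply/seteqP; split => x /=; rewrite !in_itv /=.
    by move=> [/negP + /andP[x0 x1]]; rewrite x0 /= -leNgt => h; apply/eqP; rewrite eq_le x1.
  by move=> ->; rewrite ltxx ler01 lexx andbF.
- by move=> x /= h; rewrite in_itv /=.
Qed.

Lemma lebesgue01_integral (f : R -> \bar R) : measurable_fun setT f ->
  (\int[mu]_x f x = \int[leb]_(x in `[0%R, 1%R]) f x)%E.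
Proof.
move=> mf; rewrite -(@eq_measure_integral _ _ _ _ leb mu); last first.
  by move=> A mA AD; rewrite /lebesgue01 /= /mrestr setIidl.
rewrite [RHS]integral_mkcond; apply: ae_eq_integral => //.
  by apply/(measurable_restrictT _ _).1 => //; exact: measurable_funTS.
apply: ae_imply lebesgue01_ae => x x01 _.
by rewrite patchE mem_set//= in_itv /=; apply/andP; split; lra.
Qed.

Lemma lebesgue01_setT : mu setT = 1%E.
Proof.
rewrite /lebesgue01 /= /mrestr setTI lebesgue_measure_itv /= lte_fin ltr01.
by rewrite oppr0 adde0.
Qed.

(** Monotone convergence along the intervals [0, [b n]], whose union is [0, 1): the antiderivative
    -(1 - x)^(1 - s) / (1 - s) bounds each integral by 1 / (1 - s). *)
Lemma lebesgue01_powR_lty (s : R) : 0 <= s -> s < 1 ->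
  (\int[mu]_x ((1 - x) `^ (- s))%:E < +oo)%E.
Proof.
move=> s0 s1.
have mf : measurable_fun setT (fun x : R => (1 - x) `^ (- s)).
  by apply: (measurableT_comp (measurable_powR _)) => //; exact: measurable_funB.
have mfE := (measurable_EFinP _ _).2 mf.
rewrite lebesgue01_integral// -integral_itv_bndo_bndc; last exact: measurable_funTS.
(* The shift by 2 makes [b 0] positive, so that the fundamental theorem of calculus applies on every
   interval. *)
pose b (n : nat) : R := 1 - n.+2%:R^-1.
have b1 n : b n < 1 by rewrite /b ltrBlDr ltrDl invr_gt0.
have b0 n : 0 < b n by rewrite /b subr_gt0 invf_lt1// ltr1n.
have E : `[0, 1[%classic = \bigcup_n `[0, b n]%classic.
  apply/seteqP; split => x /=; rewrite in_itv /=.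
    move=> /andP[x0 x1]; have x1' : 0 < 1 - x by lra.
    have [n nx] := ltr_add_invr x1'; rewrite add0r in nx.
    exists n => //=; rewrite in_itv /= x0 /b /=.
    have : n.+2%:R^-1 <= n.+1%:R^-1 :> R by rewrite lef_pV2 ?posrE// ler_nat.
    by move: (n.+2%:R^-1) (n.+1%:R^-1) nx => u v nx uv; lra.
  by move=> [n _ /=]; rewrite in_itv /= => /andP[-> xb]; exact: le_lt_trans (b1 n).
rewrite E.
apply: (@le_lt_trans _ _ ((1 - s)^-1)%:E); last exact: ltry.
have cv : (\int[leb]_(x in `[0%R, b i]%classic) ((1 - x) `^ (- s))%:E @[i --> \oo] -->
   \int[leb]_(x in \bigcup_i `[0%R, b i]%classic) ((1 - x) `^ (- s))%:E)%E.
  apply: ge0_nondecreasing_set_cvg_integral => //.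
  - apply/nondecreasing_seqP => n; apply/subsetPset => x /=; rewrite !in_itv /=.
    move=> /andP[-> /= /le_trans]; apply; rewrite /b lerD2l lerN2.
    by rewrite lef_pV2 ?posrE// ler_nat.
  - by move=> n; exact: measurable_funTS.
  - by move=> n x _; rewrite lee_fin powR_ge0.
apply: (cvge_le _ cv); apply: nearW => n.
pose F (x : R) : R := - (1 - s)^-1 * (1 - x) `^ (1 - s).
have dF (x : R) : x < 1 -> is_derive x (1 : R) F ((1 - x) `^ (- s)).
  move=> x1.
  have -> : F = (- (1 - s)^-1) \*: (fun y : R => (1 - y) `^ (1 - s)) by apply/funext.
  apply: (is_derive_eq (is_deriveZ (- (1 - s)^-1) (is_derive_onem_powR (1 - s) x1))).
  rewrite /GRing.scale /=; have -> : 1 - s - 1 = - s by ring.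
  by field; lra.
have cF (x : R) : x < 1 -> {for x, continuous F}.
  move=> /dF dFx; apply: differentiable_continuous; apply/derivable1_diffP.
  exact: (@ex_derive _ _ _ _ _ _ _ dFx).
rewrite (@continuous_FTC2 _ _ F) //.
- rewrite -EFinB lee_fin /F subr0 powR1 mulr1 mulNr opprK.
  have : 0 <= (1 - s)^-1 * (1 - b n) `^ (1 - s).
    by rewrite mulr_ge0 ?powR_ge0 ?invr_ge0//; lra.
  by lra.
- apply: derivable_within_continuous => x; rewrite in_itv /= => /andP[_ xb].
  have dx := is_derive_onem_powR (- s) (le_lt_trans xb (b1 n)).
  exact: (@ex_derive _ _ _ _ _ _ _ dx).
- split.
  + move=> x; rewrite in_itv /= => /andP[_ xb].
    by apply: (@ex_derive _ _ _ _ _ _ _ (dF x _)); exact: lt_trans (b1 n).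
  + exact/cvg_at_right_filter/cF.
  + exact/cvg_at_left_filter/cF.
- move=> x; rewrite in_itv /= => /andP[_ xb]; rewrite derive1E.
  by have := dF x (lt_trans xb (b1 n)) => dFx; rewrite (@derive_val _ _ _ _ _ _ _ dFx).
Qed.

End lebesgue01_facts.

(** * Power weights on the unit interval *)

Section weights.
Context (R : realType).
Notation mu := (lebesgue01 R).

Lemma measurable_L01 (p : \bar R) (p1 : (1 <= p)%E) (f : L01 p1) :
  measurable_fun setT (f : R -> R).
Proof. exact: (@measurable_Lspace _ _ R mu p p1 f). Qed.

Definition weight (a x : R) : R := (1 - x) `^ (- a).

Lemma weight_ge0 a x : 0 <= weight a x.
Proof. exact: powR_ge0. Qed.

Lemma weight0 x : weight 0 x = 1.
Proof. by rewrite /weight oppr0 powRr0. Qed.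

Lemma measurable_weight a : measurable_fun setT (weight a).
Proof.
by apply: (measurableT_comp (measurable_powR _)) => //; exact: measurable_funB.
Qed.

Lemma recip_fin (r : R) : 1 <= r -> recip r%:E = r^-1.
Proof. by move=> r1; rewrite /recip inver gt_eqF//; lra. Qed.

Lemma recipy : recip (+oo%E : \bar R) = 0.
Proof. by rewrite /recip invey. Qed.

Lemma Lnorm_weight_lty (a r : R) : 1 <= r -> 0 <= a -> a * r < 1 ->
  ('N[mu]_r%:E[EFin \o weight a] < +oo)%E.
Proof.
move=> r1 a0 ar; rewrite unlock /Lnorm; apply: poweR_lty.
under eq_integral => x _.
  have -> : (`|(EFin \o weight a) x| `^ r = ((1 - x) `^ (- (a * r)))%:E)%E.
    rewrite /= ger0_norm ?weight_ge0// /weight -powRrM mulNr//.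
  over.
by apply: lebesgue01_powR_lty => //; apply: mulr_ge0 => //; lra.
Qed.

(** The alternative [a = 0] covers q = oo, where [recip q] is 0 and the weight must be bounded. *)
Lemma weight_Lspace (q : \bar R) (q1 : (1 <= q)%E) (a : R) :
  0 <= a -> a = 0 \/ a < recip q ->
  exists w : L01 q1, (w : R -> R) = weight a %[ae mu].
Proof.
move=> a0 aq; apply: Lspace_of_fun; first exact: measurable_weight.
case: q q1 aq => [r| |//].
- rewrite lee_fin => r1; rewrite recip_fin// => ar.
  have r0 : 0 < r by lra.
  apply: Lnorm_weight_lty => //; case: ar => [->|ar]; first by rewrite mul0r.
  by rewrite -ltr_pdivlMr// div1r.
- rewrite recipy => _ [->|]; last by rewrite ltNge a0.
  rewrite unlock /Lnorm; case: ifP => // _; apply: (@le_lt_trans _ _ 1%E); last exact: ltry.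
  by apply/ess_supP; apply: nearW => x /=; rewrite weight0 normr1.
Qed.

(** Hoelder's inequality: the conjugate exponent has reciprocal 1 - 1/p, so the condition on [b]
    puts the weight in the dual of L^p. [C] is its norm there. *)
Lemma weighted_L1_bound (p : \bar R) (p1 : (1 <= p)%E) (b : R) :
  0 <= b -> b = 0 \/ b < 1 - recip p ->
  exists2 C : R, 0 <= C & forall f : L01 p1,
    (\int[mu]_y (weight b y * `|(f : R -> R) y|)%:E <= (C * `|f|)%:E)%E.
Proof.
move=> b0 bp; have mw := measurable_weight b.
have mfw (f : L01 p1) : measurable_fun setT (fun y => (weight b y * `|(f : R -> R) y|)%:E).
  apply/measurable_EFinP; apply: measurable_funM => //.
  by apply: measurableT_comp => //; exact: measurable_L01.
case: p p1 bp mfw => [r|| //] p1 bp mfw.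
- have r1 : 1 <= r by rewrite -lee_fin.
  rewrite recip_fin// in bp.
  (* For exponent 1 the conjugate one is infinite: b must be 0 and the integral is the norm of f. *)
  have [E1|rN1] := eqVneq r 1.
    subst r; exists 1 => // f; rewrite mul1r Lspace_normE Lnorm1.
    case: bp => [->|]; last by rewrite invr1 subrr ltNge b0.
    by under [leLHS] eq_integral do rewrite weight0 mul1r.
  have r1' : 1 < r by rewrite lt_def rN1.
  pose q := r / (r - 1).
  have q1 : 1 <= q by rewrite /q ler_pdivlMr; lra.
  have qE : q^-1 = 1 - r^-1 by rewrite /q invf_div; field; lra.
  have q0 : 0 < q by lra.
  have bq : b * q < 1.
    case: bp => [->|]; first by rewrite mul0r.
    by rewrite -qE -ltr_pdivlMr// div1r.
  have Nw := Lnorm_weight_lty q1 b0 bq.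
  exists (fine 'N[mu]_q%:E[EFin \o weight b]); first exact/fine_ge0/Lnorm_ge0.
  move=> f; rewrite EFinM Lspace_normE fineK ?ge0_fin_numE ?Lnorm_ge0//.
  have := @hoelder _ _ _ mu (weight b) (f : R -> R) q r mw (measurable_L01 f) q0.
  rewrite qE subrK => /(_ _ erefl); rewrite Lnorm1 => H.
  apply: le_trans (H _); last lra.
  by under [leRHS]eq_integral do rewrite /= normrM (ger0_norm (weight_ge0 _ _)).
- rewrite recipy subr0 in bp.
  have b1 : b < 1 by case: bp => [->|].
  have Iw := lebesgue01_powR_lty b0 b1.
  have Iw0 : (0 <= \int[mu]_x (weight b x)%:E)%E.
    by apply: integral_ge0 => x _; rewrite lee_fin weight_ge0.
  exists (fine (\int[mu]_x (weight b x)%:E)); first exact: fine_ge0.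
  move=> f; rewrite EFinM fineK ?ge0_fin_numE//.
  rewrite -ge0_integralZr//; first last.
  + by move=> x _; rewrite lee_fin weight_ge0.
  + exact/measurable_EFinP.
  apply: ae_ge0_le_integral => //.
  + by move=> x _; rewrite lee_fin mulr_ge0 ?weight_ge0.
  + exact: mfw.
  + by move=> x _; rewrite mule_ge0 ?lee_fin ?weight_ge0.
  + by apply: emeasurable_funM => //; exact/measurable_EFinP.
  (* The norm of L^oo is defined by cases on whether the total mass is positive; it is 1 here. *)
  have : \forall x \ae mu, (`|(f : R -> R) x|%:E <= `|f|%:E)%E.
    rewrite Lspace_normE unlock /Lnorm /= lebesgue01_setT lte01.
    exact: ess_sup_ge.
  apply: ae_imply => x fx _; rewrite -EFinM lee_fin ler_wpM2l ?weight_ge0//.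
Qed.

(** The indicators of the dyadic cells have disjoint supports of positive measure. Subspaces of
    every exact dimension therefore exist, as the enlargement to dimension n demands. *)
Lemma L01_free_family (q : \bar R) (q1 : (1 <= q)%E) (n : nat) :
  exists e : 'I_n -> L01 q1, free_family e.
Proof.
have [w wE] := @weight_Lspace q q1 0 (lexx _) (or_introl erefl).
have mD j : measurable (dyadic_cell R j) by exact: measurable_itv.
have e_ex (j : 'I_n) : exists e : L01 q1,
    (e : R -> R) = \1_(dyadic_cell R j) %[ae mu].
  apply: (@Lspace_dominated _ _ _ mu q q1 _ w); first by apply: measurable_indic; exact: mD.
  apply: ae_imply wE => x /(_ Logic.I) ->; rewrite weight0 normr1 indicE.
  by rewrite ger0_norm// lern1 leq_b1.
have [e eE] := choice e_ex.
exists e => c c0 i; apply/eqP; apply: contraT => ci.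
have allE : \forall x \ae mu, forall j, (e j : R -> R) x = \1_(dyadic_cell R j) x.
  apply: filter_forall => j; apply: ae_imply (eE j) => x; exact.
(* On cell [i] the combination equals the nonzero [c i], yet it vanishes almost everywhere; so the
   cell would be null. *)
have : \forall x \ae mu, x \notin dyadic_cell R i.
  have z := Lspace_zeroE mu q1; have := Lspace_sumE c e; rewrite c0 => H.
  apply: ae_imply2 allE (ae_imply2 (fun x h1 h2 => conj h1 h2) z H) => x Ex [zx hx].
  apply/negP => xi; move/negP: ci; apply; apply/eqP.
  have := hx Logic.I; rewrite zx// (bigD1 i)//= big1 ?addr0.
    by rewrite Ex indicE xi mulr1.
  move=> j ji; rewrite Ex indicE; case: (boolP (x \in _)); rewrite ?mulr0// => xj.
  case/eqP: ji; apply/val_inj/eqP.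
  by rewrite eqn_leq (dyadic_cell_le xi xj) (dyadic_cell_le xj xi).
move=> [N [mN N0 DN]].
have : (mu (dyadic_cell R i) <= mu N)%E.
  apply: le_measure; [by rewrite inE; exact: mD|by rewrite inE|].
  move=> x xD; apply: DN => /=.
  by apply/negP; rewrite negbK inE.
rewrite N0 leNgt => /negP; case.
have e0 : 0 < (2^-1 : R) ^+ i by apply: exprn_gt0; lra.
have e1 : (2^-1 : R) ^+ i <= 1 by apply: exprn_ile1; lra.
rewrite /lebesgue01 /= /mrestr setIidl; last first.
  move=> x; rewrite /dyadic_cell /= !in_itv /= exprS => /andP[x0 x1].
  by apply/andP; split; lra.
rewrite lebesgue_measure_itv /= lte_fin exprS.
rewrite ifT; last by lra.
by rewrite -EFinB lte_fin; lra.
Qed.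

End weights.

(** * The kernel in weighted form *)

Section kernel.
Context (R : realType).
Notation mu := (lebesgue01 R).
Notation leb := (@lebesgue_measure R).

Lemma weightD (a b x : R) : x < 1 -> weight (a + b) x = weight a x * weight b x.
Proof.
move=> x1; rewrite /weight opprD powRD//.
by apply/implyP => _; rewrite gt_eqF// subr_gt0.
Qed.

Lemma kernel_le_weights (g a b x y : R) : 0 <= a -> 0 <= b -> a + b = g ->
  0 <= x < 1 -> 0 <= y < 1 ->
  (1 - x * y) `^ (- g) <= weight a x * weight b y.
Proof.
move=> a0 b0 <- /andP[x0 x1] /andP[y0 y1].
have xy : 0 < 1 - x * y by nra.
rewrite opprD powRD; last by rewrite (gt_eqF xy) implybT.
by apply: ler_pM; rewrite ?powR_ge0//; apply: le_powRN => //; nra.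
Qed.

(** With t = 2^-m, one has t <= t^s because s <= 1, and the weight is at least 1; on the strip, 1 <=
    (t / (1 - y))^s. The constant is 4 = 3 + 1. *)
Lemma dyadic_tail_le_weight (s y : R) (m : nat) : 0 <= s <= 1 -> 0 <= y < 1 ->
  3 * 2^-1 ^+ m + (1 - 2^-1 ^+ m <= y)%R%:R <= 4 * (2^-1 ^+ m) `^ s * weight s y.
Proof.
move=> /andP[s0 s1] /andP[y0 y1]; set t : R := 2^-1 ^+ m.
have t0 : 0 < t by apply: exprn_gt0; lra.
have t1 : t <= 1 by apply: exprn_ile1; lra.
have ts : t <= t `^ s by apply: ger1_powR => //; rewrite t0.
have y0' : 0 < 1 - y by lra.
have w1 : 1 <= weight s y.
  rewrite /weight powRN invf_ge1 ?powR_gt0//.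
  have : (1 - y) `^ s <= 1 `^ s by apply: ge0_ler_powR; rewrite ?nnegrE//; lra.
  by rewrite powR1.
have tw : t `^ s <= t `^ s * weight s y by rewrite ler_peMr// powR_ge0.
rewrite -mulrA; case: (leP (1 - t) y) => ty /=; last by lra.
suff : 1 <= t `^ s * weight s y by lra.
rewrite /weight powRN ler_pdivlMr ?powR_gt0// mul1r.
by apply: ge0_ler_powR; rewrite ?nnegrE//; lra.
Qed.

Lemma kernel_finite_rank_weights (g a b s : R) (m : nat) :
  0 <= g <= 1 -> 0 <= s <= 1 -> 0 <= a -> 0 <= b -> a + b = g + s ->
  s <= a \/ s <= b ->
  exists u v : 'I_m * 'I_m -> R -> R,
  [/\ forall i, measurable_fun setT (u i), forall i, measurable_fun setT (v i),
      forall i, exists M : R, forall x : R, 0 <= x < 1 -> `|u i x| <= M,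
      forall i, exists M : R, forall x : R, 0 <= x < 1 -> `|v i x| <= M &
      forall x y : R, 0 <= x < 1 -> 0 <= y < 1 ->
        `|(1 - x * y) `^ (- g) - \sum_i u i x * v i y| <=
        4 * (2^-1 ^+ m) `^ s * weight a x * weight b y].
Proof.
move=> g01 s01 a0 b0 abgs.
(* The kernel is symmetric in x and y: exchanging [u] with [v] and [a] with [b] reduces s <= a to s
   <= b. *)
wlog sb : a b a0 b0 abgs / s <= b.
  move=> H [sa|sb]; last by apply: (H a b) => //; right.
  have [|u [v [mu_ mv bu bv uv]]] := H b a b0 a0 _ sa (or_intror sa).
    by rewrite addrC.
  exists v, u; split=> // x y x01 y01.
  rewrite mulrC (eq_bigr (fun i => u i y * v i x)); last by move=> i _; rewrite mulrC.
  by rewrite mulrAC; exact: uv.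
move=> _; have [u [v [mu_ mv bu bv uv]]] := kernel_finite_rank m g01.
exists u, v; split=> // x y x01 y01; apply: le_trans (uv x y x01 y01) _.
(* The factor of exponent s absorbs the relative error; the exponents a and b - s sum to g and
   dominate the kernel. *)
have -> : weight b y = weight s y * weight (b - s) y.
  by rewrite -weightD ?subrKC//; case/andP: y01.
have k1 : (1 - x * y) `^ (- g) <= weight a x * weight (b - s) y.
  by apply: kernel_le_weights => //; lra.
have k2 := dyadic_tail_le_weight m s01 y01.
apply: le_trans (_ : (4 * (2^-1 ^+ m) `^ s * weight s y) * (weight a x * weight (b - s) y) <= _).
  apply: ler_pM => //; last exact: powR_ge0.
by rewrite le_eqVlt; apply/orP; left; apply/eqP; ring.
Qed.

(** [D] collects the factors independent of y. The estimate is applied to the kernel, to the [v i]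
    and to the error kernel; integrability is recorded because additivity of real-valued integrals
    asks for it. *)
Lemma weighted_integral (p : \bar R) (p1 : (1 <= p)%E) (f : L01 p1) (h : R -> R)
    (b D C : R) : 0 <= D ->
  measurable_fun setT h -> (forall y, 0 <= y < 1 -> `|h y| <= D * weight b y) ->
  (\int[mu]_y (weight b y * `|(f : R -> R) y|)%:E <= (C * `|f|)%:E)%E ->
  mu.-integrable setT (EFin \o (fun y => h y * (f : R -> R) y)) /\
  `|\int[mu]_y (h y * (f : R -> R) y)| <= D * (C * `|f|).
Proof.
move=> D0 mh hb fC; have mf := measurable_L01 f.
have mhf : measurable_fun setT (fun y => h y * (f : R -> R) y) by exact: measurable_funM.
have mwf : measurable_fun setT (fun y => weight b y * `|(f : R -> R) y|).
  by apply: measurable_funM; [exact: measurable_weight|exact: measurableT_comp].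
have H : (\int[mu]_y (`|h y * (f : R -> R) y|)%:E <= (D * (C * `|f|))%:E)%E.
  apply: (@le_trans _ _ (\int[mu]_y (D%:E * (weight b y * `|(f : R -> R) y|)%:E))%E).
    apply: ae_ge0_le_integral => //.
    - by apply/measurable_EFinP; exact: measurableT_comp.
    - by move=> y _; rewrite mule_ge0 ?lee_fin// mulr_ge0 ?weight_ge0.
    - by apply: measurable_funeM; exact/measurable_EFinP.
    apply: ae_imply (lebesgue01_ae R) => y y01 _.
    by rewrite -EFinM lee_fin normrM mulrA ler_wpM2r// hb.
  rewrite ge0_integralZl//.
  - by rewrite EFinM lee_wpmul2l.
  - exact/measurable_EFinP.
  - by move=> y _; rewrite lee_fin mulr_ge0 ?weight_ge0.
have I : mu.-integrable setT (EFin \o (fun y => h y * (f : R -> R) y)).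
  apply/integrableP; split; first exact/measurable_EFinP.
  exact: le_lt_trans H (ltry _).
split=> //; apply: le_trans (le_normr_Rintegral measurableT I) _.
rewrite -lee_fin /Rintegral fineK// ge0_fin_numE.
  exact: le_lt_trans H (ltry _).
by apply: integral_ge0.
Qed.

Lemma measurable_kernel_section (alpha x : R) :
  measurable_fun setT (fun y : R => (1 - x * y) `^ (alpha - 1)).
Proof.
apply: (measurableT_comp (measurable_powR _)) => //.
by apply: measurable_funB => //; exact: measurable_funM.
Qed.

Lemma KalphaE (alpha : R) (f : R -> R) (x : R) : measurable_fun setT f ->
  Kalpha alpha f x = \int[mu]_y ((1 - x * y) `^ (alpha - 1) * f y).
Proof.
move=> mf; rewrite /Kalpha /Rintegral lebesgue01_integral//.
apply/measurable_EFinP; apply: measurable_funM => //; exact: measurable_kernel_section.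
Qed.

(** By Tonelli, the integrals over y of the positive and negative parts of the integrand are
    measurable in x; [Kalpha] is [fine] of their difference. *)
Lemma measurable_Kalpha (alpha : R) (f : R -> R) : measurable_fun setT f ->
  measurable_fun setT (Kalpha alpha f).
Proof.
move=> mf.
pose F (z : R * R) : \bar R :=
  ((1 - z.1 * z.2) `^ (alpha - 1) * (f z.2 * \1_`[0%R, 1%R] z.2))%:E.
have mF : measurable_fun setT F.
  apply/measurable_EFinP; apply: measurable_funM.
    apply: (measurableT_comp (measurable_powR _)) => //.
    apply: measurable_funB => //; apply: measurable_funM.
      exact: measurable_fst.
    exact: measurable_snd.
  apply: measurable_funM.
    by apply: measurableT_comp => //; exact: measurable_snd.
  apply: measurableT_comp; last exact: measurable_snd.
  by apply: measurable_indic; exact: measurable_itv.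
have -> : Kalpha alpha f =
    (fun x => fine (fubini_F leb F^\+ x - fubini_F leb F^\- x)%E).
  apply/funext => x; rewrite /Kalpha /Rintegral integral_mkcond; congr fine.
  transitivity (\int[leb]_y F (x, y))%E.
    apply: eq_integral => y _; rewrite patchE /F indicE /=.
    by case: ifP => _ /=; rewrite ?mulr1// !mulr0.
  rewrite integralE /fubini_F; congr (_ - _)%E; apply: eq_integral => y _.
    by rewrite !funeposE.
  by rewrite !funenegE.
apply: measurableT_comp => //; apply: emeasurable_funB.
  by apply: measurable_fun_fubini_tonelli_F => //; exact: measurable_funepos.
by apply: measurable_fun_fubini_tonelli_F => //; exact: measurable_funeneg.
Qed.

End kernel.

(** * The operator and its widths *)

Definition linear_of (R : nzRingType) (U V : lmodType R) (f : U -> V)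
    (lf : linear f) : {linear U -> V} :=
  HB.pack f (GRing.isLinear.Build R U V *:%R f lf).

Section operator.
Context (R : realType) (alpha : R) (halpha : 0 < alpha < 1).
Context (p q : \bar R) (p1 : (1 <= p)%E) (q1 : (1 <= q)%E).
Notation mu := (lebesgue01 R).

Lemma kernel_expN x y : (1 - x * y) `^ (alpha - 1) = (1 - x * y) `^ (- (1 - alpha)).
Proof. by rewrite opprB. Qed.

(** Both claims go through one induction, since additivity at each step uses the integrability of
    the partial sum. *)
Lemma Rintegral_sum (I : finType) (F : I -> R -> R) :
  (forall i, mu.-integrable setT (EFin \o F i)) ->
  mu.-integrable setT (EFin \o (fun y => \sum_i F i y)) /\
  \int[mu]_y (\sum_i F i y) = \sum_i \int[mu]_y F i y.
Proof.
move=> iF; elim: (index_enum I) => [|i s [I1 I2]].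
  rewrite big_nil; split.
    apply: (eq_integrable measurableT _ _ _ (integrable0 mu setT)) => y _ /=.
    by rewrite big_nil.
  transitivity (\int[mu]_y (0 : R)).
    by apply: eq_Rintegral => y _; rewrite big_nil.
  by rewrite Rintegral_cst ?mul0r.
rewrite big_cons; split.
  apply: (eq_integrable measurableT _ _ _ (integrableD measurableT (iF i) I1)) => y _ /=.
  by rewrite big_cons EFinD.
rewrite -I2 -RintegralD//; apply: eq_Rintegral => y _; exact: big_cons.
Qed.

Section bounds.
Context (a b : R) (a0 : 0 <= a) (b0 : 0 <= b) (ab : a + b = 1 - alpha).
Context (aq : a = 0 \/ a < recip q) (bp : b = 0 \/ b < 1 - recip p).

Lemma Kalpha_bound : exists2 C : R, 0 <= C & forall (f : L01 p1) (x : R), 0 <= x < 1 ->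
  mu.-integrable setT (EFin \o (fun y => (1 - x * y) `^ (alpha - 1) * (f : R -> R) y)) /\
  `|Kalpha alpha f x| <= weight a x * (C * `|f|).
Proof.
have [C C0 HC] := weighted_L1_bound p1 b0 bp.
exists C => // f x x01; rewrite KalphaE; last exact: measurable_L01.
have := weighted_integral (weight_ge0 a x) (measurable_kernel_section alpha x) _ (HC f).
apply.
move=> y y01; rewrite kernel_expN ger0_norm ?powR_ge0//.
exact: kernel_le_weights.
Qed.

Lemma Kalpha_operator : exists K : {linear L01 p1 -> L01 q1}, is_Kalpha alpha K.
Proof.
have [C C0 HC] := Kalpha_bound.
have [w wE] := weight_Lspace q1 a0 aq.
have K_ex (f : L01 p1) : exists u : L01 q1, (u : R -> R) = Kalpha alpha f %[ae mu].
  apply: (@Lspace_dominated _ _ _ mu q q1 _ ((C * `|f|) *: w)).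
    apply: measurable_Kalpha; exact: measurable_L01.
  have S := @Lspace_scaleE _ _ _ mu q q1 (C * `|f|) w.
  apply: ae_imply2 (lebesgue01_ae R) (ae_imply2 (fun x h1 h2 => conj h1 h2) wE S).
  move=> x x01 [/(_ Logic.I) wx /(_ Logic.I) Sx].
  have -> : ((C * `|f|) *: w : L01 q1) x = (C * `|f|) * w x by [].
  rewrite wx [leRHS]ger0_norm ?mulr_ge0 ?weight_ge0// mulrC.
  exact: (HC f x x01).2.
have [K KE] := choice K_ex.
have lK : linear K.
  move=> c f g; apply: Lspace_eqP.
  have S := @Lspace_scaleE _ _ _ mu q q1 c (K f).
  have D := @Lspace_addE _ _ _ mu q q1 (c *: K f) (K g).
  have KK := ae_imply2 (fun x h1 h2 => conj h1 h2) (KE f) (KE g).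
  have SD := ae_imply2 (fun x h1 h2 => conj h1 h2) S D.
  have KS := ae_imply2 (fun x h1 h2 => conj h1 h2) KK SD.
  have KL := ae_imply2 (fun x h1 h2 => conj h1 h2) (KE (c *: f + g)) (lebesgue01_ae R).
  apply: ae_imply2 KL KS => x [h1 x01] [[h2 h3] [h4 h5]] _.
  rewrite (h5 Logic.I) /= (h4 Logic.I) (h2 Logic.I) (h3 Logic.I) (h1 Logic.I).
  have [If _] := HC f x x01; have [Ig _] := HC g x x01.
  rewrite !KalphaE; try exact: measurable_L01.
  rewrite -RintegralZl// -RintegralD//; last first.
    exact: (integrableZl measurableT c If).
  (* Operations on classes in L^p are pointwise only almost everywhere, so the integrands are
     compared almost everywhere. *)
  congr fine; apply: ae_eq_integral => //.
  - apply/measurable_EFinP; apply: measurable_funM; first exact: measurable_kernel_section.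
    exact: measurable_L01.
  - apply/measurable_EFinP; apply: measurable_funD.
      apply: measurable_funM => //.
      by apply: measurable_funM; [exact: measurable_kernel_section|exact: measurable_L01].
    by apply: measurable_funM; [exact: measurable_kernel_section|exact: measurable_L01].
  have S' := @Lspace_scaleE _ _ _ mu p p1 c f.
  have D' := @Lspace_addE _ _ _ mu p p1 (c *: f) g.
  apply: ae_imply2 S' D' => y /(_ Logic.I) Sy /(_ Logic.I) Dy _.
  by congr EFin; rewrite [(_ + _ : L01 p1) y]Dy /= [(_ *: _ : L01 p1) y]Sy; ring.
by exists (linear_of lK).
Qed.

End bounds.

Section width.
Context (s a b : R) (s01 : 0 <= s <= 1) (a0 : 0 <= a) (b0 : 0 <= b).
Context (ab : a + b = (1 - alpha) + s) (sab : s <= a \/ s <= b).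
Context (aq : a = 0 \/ a < recip q) (bp : b = 0 \/ b < 1 - recip p).
Context (K : {linear L01 p1 -> L01 q1}) (HK : is_Kalpha alpha K).
(** Supplied by [Kalpha_bound] for a pair of exponents with sum 1 - alpha; the pair of this section
    has sum 1 - alpha + s. *)
Hypothesis Kint : forall (f : L01 p1) (x : R), 0 <= x < 1 ->
  mu.-integrable setT (EFin \o (fun y => (1 - x * y) `^ (alpha - 1) * (f : R -> R) y)).

(** The difference between K f and its approximant is the integral of the error kernel against f,
    hence dominated almost everywhere by a multiple of [w]. The rank m^2 explains the condition on
    [n]. *)
Lemma Kalpha_width_le : exists C : R, 0 <= C /\ forall m n : nat, (m * m <= n)%N ->
  (operator_width n K <= (C * (2^-1 ^+ m) `^ s)%:E)%E.
Proof.
have [C C0 HC] := weighted_L1_bound p1 b0 bp.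
have [C1 C10 HC1] := @weighted_L1_bound _ _ p1 0 (lexx 0) (or_introl erefl).
have [w wE] := weight_Lspace q1 a0 aq.
have [w0 w0E] := @weight_Lspace _ _ q1 0 (lexx 0) (or_introl erefl).
exists (4 * C * `|w|); split; first by rewrite !mulr_ge0.
move=> m n mn; have g01 : 0 <= 1 - alpha <= 1.
  by case/andP: halpha => al0 al1; rewrite subr_ge0 ltW//= gerBl ltW.
have [u [v [mu_ mv bu bv uv]]] := kernel_finite_rank_weights m g01 s01 a0 b0 ab sab.
have U_ex i : exists U : L01 q1, (U : R -> R) = u i %[ae mu].
  have [M HM] := bu i.
  apply: (@Lspace_dominated _ _ _ mu q q1 _ (M *: w0)); first exact: mu_.
  have S := @Lspace_scaleE _ _ _ mu q q1 M w0.
  apply: ae_imply2 (lebesgue01_ae R) (ae_imply2 (fun x h1 h2 => conj h1 h2) w0E S).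
  move=> x x01 [/(_ Logic.I) wx /(_ Logic.I) Sx].
  have -> : (M *: w0 : L01 q1) x = M * w0 x by [].
  rewrite wx weight0 mulr1; apply: le_trans (HM x x01) _; exact: ler_norm.
have [U UE] := choice U_ex.
apply: (@operator_width_le _ _ _ K _ U); first exact: L01_free_family.
  by rewrite card_prod card_ord.
(* Integrating the separated kernel against f gives the combination of the [U i] with these
   coefficients. *)
move=> f f1; pose c i := \int[mu]_y (v i y * (f : R -> R) y); exists c.
have Iv i : mu.-integrable setT (EFin \o (fun y => v i y * (f : R -> R) y)).
  have [M HM] := bv i.
  have M0 : 0 <= M by apply: le_trans (HM 0 _) => //; rewrite lexx ltr01.
  apply: (@weighted_integral _ p p1 f (v i) 0 M C1 M0 (mv i) _ (HC1 f)).1 => y y01.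
  by rewrite weight0 mulr1; exact: HM.
set ts := (2^-1 ^+ m) `^ s.
have ts0 : 0 <= ts by exact: powR_ge0.
have D0 : 0 <= 4 * ts * (C * `|f|) by rewrite !mulr_ge0.
apply: (@le_trans _ _ `|(4 * ts * (C * `|f|)) *: w|); last first.
  rewrite normrZ ger0_norm//.
  have -> : 4 * C * `|w| * ts = 4 * ts * (C * 1) * `|w| by ring.
  by rewrite ler_wpM2r// ler_wpM2l ?mulr_ge0// ler_wpM2l.
apply: le_Lspace_norm.
have allU : \forall x \ae mu, forall i, (U i : R -> R) x = u i x.
  by apply: filter_forall => i; apply: ae_imply (UE i) => x; exact.
have A1 := @Lspace_addE _ _ _ mu q q1 (K f) (- (\sum_i c i *: U i)).
have A2 := @Lspace_oppE _ _ _ mu q q1 (\sum_i c i *: U i).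
have A3 := @Lspace_sumE _ _ _ mu q q1 _ c U.
have A4 := @Lspace_scaleE _ _ _ mu q q1 (4 * ts * (C * `|f|)) w.
have A12 := ae_imply2 (fun x h1 h2 => conj h1 h2) A1 A2.
have A34 := ae_imply2 (fun x h1 h2 => conj h1 h2) A3 A4.
have A1234 := ae_imply2 (fun x h1 h2 => conj h1 h2) A12 A34.
have B1 := ae_imply2 (fun x h1 h2 => conj h1 h2) (HK f) wE.
have B2 := ae_imply2 (fun x h1 h2 => conj h1 h2) (lebesgue01_ae R) allU.
have B12 := ae_imply2 (fun x h1 h2 => conj h1 h2) B1 B2.
apply: ae_imply2 A1234 B12.
move=> x [[/(_ Logic.I) h1 /(_ Logic.I) h2] [/(_ Logic.I) h3 /(_ Logic.I) h4]].
move=> [[/(_ Logic.I) h5 /(_ Logic.I) h6] [x01 h7]].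
rewrite [X in `|X| <= _]h1 /= [X in _ + X]h2 /= [X in _ - X]h3 [X in _ <= `|X|]h4 h5 h6.
have mf := measurable_L01 f.
rewrite KalphaE//.
have Ic i : mu.-integrable setT (EFin \o (fun y => u i x * (v i y * (f : R -> R) y))).
  exact: (integrableZl measurableT (u i x) (Iv i)).
have [I1 I2] := Rintegral_sum Ic.
have -> : \sum_i c i * (U i : R -> R) x =
    \int[mu]_y (\sum_i u i x * (v i y * (f : R -> R) y)).
  rewrite I2; apply: eq_bigr => i _; rewrite h7 mulrC.
  by rewrite RintegralZl.
rewrite -RintegralB//; last exact: Kint.
pose h y := (1 - x * y) `^ (- (1 - alpha)) - \sum_i u i x * v i y.
have -> : \int[mu]_y ((1 - x * y) `^ (alpha - 1) * (f : R -> R) y -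
    \sum_i u i x * (v i y * (f : R -> R) y)) = \int[mu]_y (h y * (f : R -> R) y).
  apply: eq_Rintegral => y _; rewrite /h kernel_expN mulrBl mulr_suml.
  by congr (_ - _); apply: eq_bigr => i _; rewrite mulrA.
rewrite [leRHS]ger0_norm ?mulr_ge0 ?weight_ge0//.
have mh : measurable_fun setT h.
  apply: measurable_funB.
    by rewrite (_ : (fun _ => _) = (fun y => (1 - x * y) `^ (alpha - 1)));
      [exact: measurable_kernel_section|apply/funext => y; rewrite kernel_expN].
  by apply: measurable_sum => i; apply: measurable_funM.
have D1 : 0 <= 4 * ts * weight a x by rewrite !mulr_ge0 ?weight_ge0.
have [_ H] := weighted_integral D1 mh (fun y y01 => uv x y x01 y01) (HC f).
apply: le_trans H _; rewrite le_eqVlt; apply/orP; left; apply/eqP; ring.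
Qed.

(** [m] is the integer part of sqrt n, and sqrt n <= m + 1 costs the factor 2^s. *)
Lemma Kalpha_root_exp : root_exp_bigO s (fun n => operator_width n K).
Proof.
have [C [C0 HC]] := Kalpha_width_le.
exists (C * 2 `^ s); apply: nearW => n.
have [m /andP[mn nm]] : exists m, (m * m <= n < m.+1 * m.+1)%N.
  elim: n => [|n [m /andP[h1 h2]]]; first by exists 0%N.
  have [h3|h3] := leqP (m.+1 * m.+1) n.+1; last by exists m; rewrite h3 leqW.
  by exists m.+1; rewrite h3; apply: leq_ltn_trans h2 _; exact: ltn_mul.
apply: le_trans (HC m n mn) _; rewrite lee_fin -mulrA; apply: ler_wpM2l => //.
rewrite -powRD; last by apply/implyP => _; rewrite pnatr_eq0.
have -> : (2^-1 : R) ^+ m = 2 `^ (- m%:R) by rewrite powR_invn// exprVn.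
rewrite -powRrM; apply: ler_powR; first by lra.
have sn : Num.sqrt n%:R <= m%:R + 1 :> R.
  have m0 : 0 <= m%:R + 1 :> R by rewrite addr_ge0.
  rewrite -[leRHS](ger0_norm m0) -sqrtr_sqr ler_sqrt ?exprn_ge0//.
  by rewrite natr1 expr2 -natrM ler_nat ltnW.
case/andP: s01 => s0 s1; have := ler_wpM2l s0 sn; lra.
Qed.

End width.
End operator.

(** * Choice of the exponents in the three cases *)

Section main_cases.
Context (R : realType).

(** The pair [a], [b] makes the operator bounded and fixes [K] once; the pair [a'], [b'], whose sum
    is larger by k, may change with the rate k. *)
Lemma Kalpha_operator_root_exp (alpha : R) (p q : \bar R)
    (p1 : (1 <= p)%E) (q1 : (1 <= q)%E) (kmax a b : R) :
  0 < alpha < 1 -> 0 <= a -> 0 <= b -> a + b = 1 - alpha ->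
  a = 0 \/ a < recip q -> b = 0 \/ b < 1 - recip p ->
  (forall k, 0 < k -> k < kmax -> k <= 1 /\ exists a' b',
    [/\ 0 <= a' /\ 0 <= b', a' + b' = 1 - alpha + k, k <= a' \/ k <= b',
        a' = 0 \/ a' < recip q & b' = 0 \/ b' < 1 - recip p]) ->
  exists2 K : {linear L01 p1 -> L01 q1}, is_Kalpha alpha K &
    forall k, 0 < k -> k < kmax -> root_exp_bigO k (fun n => operator_width n K).
Proof.
move=> halpha a0 b0 ab aq bp H.
have [K HK] := Kalpha_operator p1 q1 a0 b0 ab aq bp.
exists K => // k k0 kmaxk; have [k1 [a' [b' [[a'0 b'0] ab' kab aq' bp']]]] := H k k0 kmaxk.
have [C C0 HC] := Kalpha_bound p1 a0 b0 ab bp.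
have k01 : 0 <= k <= 1 by rewrite ltW.
apply: (Kalpha_root_exp halpha k01 a'0 b'0 ab' kab aq' bp' HK) => f x x01.
exact: (HC f x x01).1.
Qed.

Lemma recip_ge0 (p : \bar R) : (1 <= p)%E -> 0 <= recip p.
Proof.
case: p => [r| |//]; last by rewrite recipy.
by rewrite lee_fin => r1; rewrite recip_fin// invr_ge0; lra.
Qed.

(** Here 1 / sqrt 2 <= 1, and [c] is positive because [k] is. *)
Lemma invsqrt2_mul_lt (k c : R) : 0 < k -> k < (Num.sqrt 2)^-1 * c -> k < c.
Proof.
move=> k0; set t := (Num.sqrt 2)^-1 => kc.
have t0 : 0 < t by rewrite invr_gt0 sqrtr_gt0.
have t1 : t <= 1 by rewrite invf_le1 ?sqrtr_gt0// -[leLHS]sqrtr1 ler_sqrt//; lra.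
have c0 : 0 < c by rewrite -(pmulr_rgt0 _ t0); exact: lt_trans kc.
by apply: lt_le_trans kc _; rewrite ler_piMl// ltW.
Qed.

End main_cases.

Theorem theorem1 (R : realType) (alpha : R) (halpha : 0 < alpha < 1)
    (p : \bar R) (p1 : (1 <= p)%E) :
  [/\ (recip p < alpha ->
        exists2 K : {linear L01 p1 -> L01 (leey (1 : \bar R))},
          is_Kalpha alpha K &
          forall kappa1 : R,
            0 < kappa1 -> kappa1 < (Num.sqrt 2)^-1 * (alpha - recip p) ->
            root_exp_bigO kappa1 (fun n => operator_width n K)),
      (forall (r : R) (r1 : (1 <= r%:E)%E), alpha = recip p ->
        exists2 K : {linear L01 p1 -> L01 r1},
          is_Kalpha alpha K &
          forall kappa2 : R,
            0 < kappa2 -> kappa2 < (Num.sqrt 2)^-1 * r^-1 ->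
            root_exp_bigO kappa2 (fun n => operator_width n K)) &
      (forall (r : R) (r1 : (1 <= r%:E)%E), 1 - r^-1 < alpha -> alpha < recip p ->
        exists2 K : {linear L01 p1 -> L01 r1},
          is_Kalpha alpha K &
          forall kappa3 : R,
            0 < kappa3 -> kappa3 < (Num.sqrt 2)^-1 * (1 - recip p) ->
            root_exp_bigO kappa3 (fun n => operator_width n K))].
Proof.
case/andP: (halpha) => al0 al1; have rp := recip_ge0 p1.
split.
- move=> pal.
  (* The target L^oo forces a = 0; the hypothesis 1/p < alpha is what b = 1 - alpha requires. *)
  have bp : 1 - alpha = 0 \/ 1 - alpha < 1 - recip p by right; lra.
  apply: (Kalpha_operator_root_exp _ _ (a := 0) (b := 1 - alpha) _ _ _ _ (or_introl _) bp);
    rewrite ?add0r ?subr_ge0 ?(ltW al1)//.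
  move=> k k0 /(invsqrt2_mul_lt k0) kk; split; first lra.
  (* Here b' < 1 - 1/p amounts to k < alpha - 1/p. *)
  exists 0, (1 - alpha + k); split; [lra|lra|right; lra|by left|right; lra].
- move=> r r1 alE.
  have r1' : 1 <= r by rewrite -lee_fin.
  have ri0 : 0 < r^-1 by rewrite invr_gt0; lra.
  have ri1 : r^-1 <= 1 by rewrite invf_le1//; lra.
  have Hmin (e : R) : 0 < e -> exists d, [/\ 0 < d, d <= 1 - alpha & d <= e].
    move=> e0; exists (Num.min (1 - alpha) e).
    by rewrite lt_min subr_gt0 al1 e0 !ge_min !lexx orbT.
  (* Now 1 - 1/p = 1 - alpha, so b must stay strictly below 1 - alpha: a small [d] is moved to the x
     side, where 1/r leaves room. *)
  have [d [d0 d1 d2]] : exists d, [/\ 0 < d, d <= 1 - alpha & d <= r^-1 / 2].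
    by apply: Hmin; lra.
  have aq : d = 0 \/ d < recip r%:E by right; rewrite recip_fin//; lra.
  have bp : 1 - alpha - d = 0 \/ 1 - alpha - d < 1 - recip p by right; lra.
  apply: (Kalpha_operator_root_exp _ _ _ _ _ _ aq bp); rewrite ?subrKC ?subr_ge0 ?(ltW d0)//.
  move=> k k0 /(invsqrt2_mul_lt k0) kk; split; first lra.
  (* A new shift depending on k keeps e + k below 1/r; the whole gain is taken in the exponent of
     x. *)
  have [e [e0 e1 e2]] : exists d, [/\ 0 < d, d <= 1 - alpha & d <= (r^-1 - k) / 2].
    by apply: Hmin; lra.
  exists (e + k), (1 - alpha - e); split; [lra|lra|left; lra| |right; lra].
  by right; rewrite recip_fin//; lra.
- move=> r r1 ral alp.
  have r1' : 1 <= r by rewrite -lee_fin.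
  (* The hypothesis 1 - 1/r < alpha lets the x side carry the full exponent 1 - alpha. *)
  have aq : 1 - alpha = 0 \/ 1 - alpha < recip r%:E by right; rewrite recip_fin//; lra.
  apply: (Kalpha_operator_root_exp _ _ (b := 0) _ _ _ _ aq (or_introl _));
    rewrite ?addr0 ?subr_ge0 ?(ltW al1)//.
  move=> k k0 /(invsqrt2_mul_lt k0) kk; split; first lra.
  (* The y side, free up to 1 - 1/p, takes the whole gain k. *)
  exists (1 - alpha), k; split; [lra|lra|right; lra| |right; lra].
  by right; rewrite recip_fin//; lra.
Qed.
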